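(* Let $q = p^n$ be a power of an odd prime $p$, $n \ge 1$. Then: (i) every vector in $\mathbb{F}_q^2$ is the sum of two unit vectors if and only if $q = 3$; (ii) every vector in $\mathbb{F}_q^2$ is the sum of four unit vectors; (iii) if $q \equiv 3 \pmod 4$, then every nonzero vector in $\mathbb{F}_q^2$ is the sum of three unit vectors; (iv) the zero vector of $\mathbb{F}_q^2$ is the sum of three unit vectors if and only if $p \equiv 1, 3, 11 \pmod{12}$ or $n$ is even.
   Context: For $x \in \mathbb{F}_q^d$, $\|x\| = x_1^2+\dots+x_d^2 \in \mathbb{F}_q$, and $x$ is a unit vector if and only if $\|x\| = 1$. ''$x$ is the sum of $m$ unit vectors'' means $x = u_1+\dots+u_m$ with each $u_j$ a unit vector in the same space, repetitions allowed. *)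

(* Defs.v *)
From HB Require Import structures.
From mathcomp Require Import all_boot all_order all_algebra.

Set Implicit Arguments.
Unset Strict Implicit.
Unset Printing Implicit Defensive.

Import GRing.Theory.
Local Open Scope ring_scope.

(* The F-valued quadratic form written ||x||; no square root is taken. *)
Definition sqnorm (F : finFieldType) (d : nat) (x : 'rV[F]_d) : F :=
  \sum_(i < d) x 0 i ^+ 2.

Definition unit_vector (F : finFieldType) (d : nat) (x : 'rV[F]_d) : Prop :=
  sqnorm x = 1.

Definition sum_of_unit_vectors (F : finFieldType) (d m : nat)
    (x : 'rV[F]_d) : Prop :=
  exists2 u : 'I_m -> 'rV[F]_d,
    forall j, unit_vector (u j) & x = \sum_(j < m) u j.

(* Main.v *)
Require Import Defs.
From HB Require Import structures.
From mathcomp Require Import all_boot all_order all_algebra.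
From mathcomp Require Import finfield ring zify.

(** Write N = ||x||.  If x = u + v with u, v unit vectors, then u is the sum of
    x / 2 and a multiple (r / 2) x', where x' is x turned by a right angle, and
    ||u|| = N (1 + r^2) / 4.  So, when N <> 0, x is a sum of two unit vectors
    exactly when N (1 + r^2) = 4 for some r, that is, when 4 / N - 1 is a square
    ([two_unit_norm_sum], [two_unit_sum_norm]).  Everything else is about which
    N satisfy this condition; call them two-unit norms.

    (i) The isotropic vector (1, i), with i^2 = -1, is not a sum of two unit
    vectors, so if all vectors are such sums then -1 is not a square.  The
    vectors (2b, 0) show that 1 - b^2 is then a square for all b <> 0; using
    this for 1 / b as well, b^2 - 1 is a square too, hence b^2 = 1 for every
    b <> 0 and q = 3.

    (iv) 0 is a sum of three unit vectors iff a unit vector is a sum of two,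
    i.e. iff 1 + r^2 = 4 is solvable, i.e. iff 3 is a square in F.  This holds
    if p = 3.  Otherwise q modulo 12 decides: -1 is a square iff 4 divides
    q - 1, and -3 is a square iff F contains primitive cube roots of unity,
    i.e. iff 3 divides q - 1 ([sqrt3P]).

    (iii) When -1 is not a square, the form is anisotropic and the unit circle
    has at least q points.  A line meets the circle in at most two points, so
    the linear form u |-> x.u takes more than q / 2 values on the circle.
    Hence the set of norms ||x - u|| = ||x|| + 1 - 2 x.u and the set of norms
    ||e1 + v|| = 2 + 2 v_1 meet, and then x - u is a sum of two unit vectors
    ([three_unit_anisotropic]).  In this case (ii) follows at once.

    (ii) when i^2 = -1.  In the coordinates (s, t) = (a + i b, a - i b) the norm
    is s t, so x = (c, d) must be split into two vectors whose products of
    coordinates lie in the set S of two-unit norms.  The cases c d = 0 and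
    c d in S are easy; in the others scaling gives x = (M, 1), M = c d.  If for
    some t <> 0, 1 the sets S / t and M - S / (1 - t) meet, we are done.
    Otherwise, because |S| >= (q - 1) / 2, they cover all but one element of F.
    When M (1 - t) is outside S the missing element is 0; adding up all the
    elements then gives an equation of degree two in t.  So at most two such t
    exist, which forces q = 5, where the splitting is explicit
    ([norm_splitting]). *)

Set Implicit Arguments.
Unset Strict Implicit.
Unset Printing Implicit Defensive.

Import GRing.Theory.
Local Open Scope ring_scope.

(** * Plane vectors and concatenation of sums *)

(** Reduces an equation that follows linearly from another one to a ring or
    field identity. *)
Lemma eq_of_multiple (R : pzRingType) (k a b x y : R) :
  a = b -> x - y = k * (a - b) -> x = y.
Proof. by move=> ->; rewrite subrr mulr0 => /subr0_eq. Qed.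

Definition vec2 (F : finFieldType) (a b : F) : 'rV[F]_2 :=
  \row_(j < 2) [:: a; b]`_j.

Definition dot2 (F : finFieldType) (x y : 'rV[F]_2) : F :=
  x 0 0 * y 0 0 + x 0 1 * y 0 1.

Lemma vec2_eta (F : finFieldType) (x : 'rV[F]_2) : x = vec2 (x 0 0) (x 0 1).
Proof.
by apply/rowP => j; rewrite mxE; case: j => [[|[|j]] lt_j] //=; congr (x _ _);
  apply: val_inj.
Qed.

Lemma vec2_0 (F : finFieldType) (a b : F) : vec2 a b 0 0 = a.
Proof. by rewrite mxE. Qed.

Lemma vec2_1 (F : finFieldType) (a b : F) : vec2 a b 0 1 = b.
Proof. by rewrite mxE. Qed.

Lemma row2_eq (F : finFieldType) (x y : 'rV[F]_2) :
  x 0 0 = y 0 0 -> x 0 1 = y 0 1 -> x = y.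
Proof. by move=> e0 e1; rewrite [x]vec2_eta [y]vec2_eta e0 e1. Qed.

Lemma sqnorm2 (F : finFieldType) (x : 'rV[F]_2) :
  sqnorm x = x 0 0 ^+ 2 + x 0 1 ^+ 2.
Proof.
rewrite /sqnorm big_ord_recl big_ord1.
by congr (_ + x _ _ ^+ 2); apply: val_inj.
Qed.

Lemma sqnorm_vec2 (F : finFieldType) (a b : F) :
  sqnorm (vec2 a b) = a ^+ 2 + b ^+ 2.
Proof. by rewrite sqnorm2 vec2_0 vec2_1. Qed.

Lemma sqnormN (F : finFieldType) d (x : 'rV[F]_d) : sqnorm (- x) = sqnorm x.
Proof. by apply: eq_bigr => i _; rewrite mxE sqrrN. Qed.

Lemma sqnormB (F : finFieldType) (x y : 'rV[F]_2) :
  sqnorm (x - y) = sqnorm x + sqnorm y - 2%:R * dot2 x y.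
Proof. by rewrite !sqnorm2 /dot2 !mxE; ring. Qed.

Lemma unit_e1 (F : finFieldType) : unit_vector (vec2 (1 : F) 0).
Proof. by rewrite /unit_vector sqnorm_vec2 expr1n expr0n addr0. Qed.

Lemma sum_of_unit_vectorsD (F : finFieldType) d m n (x y : 'rV[F]_d) :
  sum_of_unit_vectors m x -> sum_of_unit_vectors n y ->
  sum_of_unit_vectors (m + n) (x + y).
Proof.
move=> [u unit_u ->] [v unit_v ->].
exists (fun j => match split j with inl i => u i | inr i => v i end).
  by move=> j; case: split.
rewrite big_split_ord /=; congr (_ + _); apply: eq_bigr => i _.
  by rewrite -[lshift _ _]/(unsplit (inl i)) unsplitK.
by rewrite -[rshift _ _]/(unsplit (inr i)) unsplitK.
Qed.

Lemma sum_of_unit_vectors1 (F : finFieldType) d (x : 'rV[F]_d) :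
  unit_vector x -> sum_of_unit_vectors 1 x.
Proof. by move=> unit_x; exists (fun=> x); rewrite ?big_ord1. Qed.

Lemma sum_of_unit_vectorsS (F : finFieldType) d m (x u : 'rV[F]_d) :
  unit_vector u -> sum_of_unit_vectors m (x - u) ->
  sum_of_unit_vectors m.+1 x.
Proof.
move=> unit_u sum_xu; rewrite -[x](subrKC u) -add1n.
exact/sum_of_unit_vectorsD/sum_xu/sum_of_unit_vectors1.
Qed.

Lemma sum_of_two_unit_vectorsP (F : finFieldType) d (x : 'rV[F]_d) :
  sum_of_unit_vectors 2 x <->
  exists2 u : 'rV[F]_d, unit_vector u & unit_vector (x - u).
Proof.
split=> [[u unit_u ->] | [u unit_u unit_xu]].
  exists (u ord0) => //; rewrite big_ord_recl big_ord1.
  by rewrite addrC addKr; apply: unit_u.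
exact: (sum_of_unit_vectorsS unit_u) (sum_of_unit_vectors1 unit_xu).
Qed.

Lemma sum_of_two_unit_vectors0 (F : finFieldType) :
  sum_of_unit_vectors 2 (0 : 'rV[F]_2).
Proof.
apply/sum_of_two_unit_vectorsP; exists (vec2 1 0); first exact: unit_e1.
by rewrite /unit_vector sub0r sqnormN; apply: unit_e1.
Qed.

(** * The two-unit criterion *)

(** The condition that N is nonzero and 4 / N - 1 is a square, without division.
    In characteristic other than 2 it excludes N = 0 by itself. *)
Definition two_unit_norm (F : finFieldType) (N : F) : Prop :=
  exists r, N * (1 + r ^+ 2) = 4%:R.

Lemma natr4_neq0 (F : finFieldType) : (2%:R : F) != 0 -> (4%:R : F) != 0.
Proof. by move=> nz2; rewrite -[4%N]/(2 * 2)%N natrM mulf_neq0. Qed.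

(** The two unit vectors are (x + r x') / 2 and (x - r x') / 2, where x' is x
    turned by a right angle. *)
Lemma two_unit_norm_sum (F : finFieldType) (x : 'rV[F]_2) :
  (2%:R : F) != 0 -> two_unit_norm (sqnorm x) -> sum_of_unit_vectors 2 x.
Proof.
move=> nz2 [r Nr]; have nz4 := natr4_neq0 nz2; rewrite sqnorm2 in Nr.
apply/sum_of_two_unit_vectorsP.
exists (vec2 ((x 0 0 - r * x 0 1) / 2%:R) ((x 0 1 + r * x 0 0) / 2%:R)).
  rewrite /unit_vector sqnorm_vec2; apply: (eq_of_multiple (k := 4%:R^-1) Nr).
  by field; rewrite nz4 nz2.
rewrite /unit_vector sqnorm2 !mxE /=; apply: (eq_of_multiple (k := 4%:R^-1) Nr).
by field; rewrite nz4 nz2.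
Qed.

(** The orthogonal component of u relative to x gives r: since ||x - u|| = 1,
    2 x.u = ||x||, and Lagrange's identity (x.u)^2 + (x ^ u)^2 = ||x|| ||u||
    determines the square of the cross product x ^ u = ||x|| r / 2. *)
Lemma two_unit_sum_norm (F : finFieldType) (x : 'rV[F]_2) :
  sqnorm x != 0 -> sum_of_unit_vectors 2 x -> two_unit_norm (sqnorm x).
Proof.
move=> nzx /sum_of_two_unit_vectorsP [u]; rewrite /unit_vector !sqnorm2 !mxE.
move=> unit_u unit_xu; rewrite sqnorm2 in nzx *.
move: (x 0 0) (x 0 1) (u 0 0) (u 0 1) nzx unit_u unit_xu => a b c d nzx u1 xu1.
exists (2%:R * (a * d - b * c) / (a ^+ 2 + b ^+ 2)).
have dotE : 2%:R * (a * c + b * d) = a ^+ 2 + b ^+ 2.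
  have -> : 2%:R * (a * c + b * d) = a ^+ 2 + b ^+ 2 + (c ^+ 2 + d ^+ 2)
    - ((a - c) ^+ 2 + (b - d) ^+ 2) by ring.
  by rewrite u1 xu1 addrK.
have crossE : (2%:R * (a * d - b * c)) ^+ 2 =
    4%:R * (a ^+ 2 + b ^+ 2) * (c ^+ 2 + d ^+ 2)
    - (2%:R * (a * c + b * d)) ^+ 2.
  by ring.
rewrite expr_div_n crossE dotE u1; by field.
Qed.

(** If u + v + w = 0, then -u is a sum of two unit vectors and has norm 1; the
    criterion for N = 1 reads r^2 = 3. *)
Lemma zero_three_unit (F : finFieldType) : (2%:R : F) != 0 ->
  sum_of_unit_vectors 3 (0 : 'rV[F]_2) <-> exists r : F, r ^+ 2 = 3%:R.
Proof.
move=> nz2; have nz1 : (1 : F) != 0 by apply: oner_neq0.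
split=> [[u unit_u]|[r r2]].
  rewrite big_ord_recl => /esym/eqP; rewrite addrC addr_eq0 => /eqP sumE.
  have sq1 : sqnorm (- u ord0) = 1 by rewrite sqnormN; apply: unit_u.
  have : two_unit_norm (sqnorm (- u ord0)).
    apply: two_unit_sum_norm; rewrite ?sq1 //.
    by rewrite -sumE; exists (fun i => u (lift ord0 i)).
  rewrite sq1 => -[r]; rewrite mul1r => rE; exists r.
  by apply: (eq_of_multiple (k := 1) rE); ring.
apply: (sum_of_unit_vectorsS (unit_e1 F)); apply: two_unit_norm_sum => //.
by rewrite sub0r sqnormN unit_e1; exists r; rewrite r2; ring.
Qed.

(** * Planes in which every vector is a sum of two unit vectors *)

(** If u and x - u are unit vectors and ||x|| = 0, then u is orthogonal to
    x = (1, i), hence proportional to x, hence isotropic: a contradiction. *)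
Lemma isotropic_not_two_unit (F : finFieldType) (i : F) :
  (2%:R : F) != 0 -> i ^+ 2 = -1 -> ~ sum_of_unit_vectors 2 (vec2 1 i).
Proof.
move=> nz2 i2 /sum_of_two_unit_vectorsP [u].
rewrite /unit_vector => unit_u; rewrite sqnormB unit_u sqnorm_vec2 i2 expr1n.
rewrite subrr add0r => /eqP; rewrite -subr_eq0 addrAC subrr add0r oppr_eq0.
rewrite mulf_eq0 (negPf nz2) /= /dot2 vec2_0 vec2_1 mul1r addr_eq0 => /eqP u0E.
move: unit_u; rewrite sqnorm2 u0E sqrrN exprMn i2 mulN1r addNr => /esym/eqP.
by rewrite oner_eq0.
Qed.

(** The criterion for (2b, 0) makes 1 - b^2 a square c^2, and for (2/b, 0) it
    makes b^2 - 1 a square.  If c <> 0, the quotient is a square root of -1,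
    contrary to [isotropic_not_two_unit]. *)
Lemma all_two_unit_sqr1 (F : finFieldType) :
  (2%:R : F) != 0 -> (forall x : 'rV[F]_2, sum_of_unit_vectors 2 x) ->
  forall b : F, b != 0 -> b ^+ 2 = 1.
Proof.
move=> nz2 sum2.
have nz4 := natr4_neq0 nz2.
have sqrB (b : F) : b != 0 -> exists c, c ^+ 2 = 1 - b ^+ 2.
  move=> nzb.
  have normE : sqnorm (vec2 (2%:R * b) 0) = 4%:R * b ^+ 2.
    by rewrite sqnorm_vec2; ring.
  have nz_norm : sqnorm (vec2 (2%:R * b) 0) != 0.
    by rewrite normE mulf_neq0 // expf_neq0.
  have [r] := two_unit_sum_norm nz_norm (sum2 _); rewrite normE => rE.
  exists (b * r); apply: (eq_of_multiple (k := 4%:R^-1) rE).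
  by field.
move=> b nzb; have [c cE] := sqrB b nzb.
have [|d dE] := sqrB b^-1; first by rewrite invr_eq0.
have cdE : c ^+ 2 = - (b * d) ^+ 2 by rewrite cE exprMn dE; field.
have [c0 | nzc] := eqVneq c 0.
  by apply/eqP; rewrite eq_sym -subr_eq0 -cE c0 expr0n.
case: (@isotropic_not_two_unit F (b * d / c)) => //.
by rewrite expr_div_n -[(b * d) ^+ 2]opprK -cdE mulNr divff // expf_neq0.
Qed.

Lemma all_two_unit_card (F : finFieldType) :
  (2%:R : F) != 0 -> (forall x : 'rV[F]_2, sum_of_unit_vectors 2 x) ->
  (#|F| <= 3)%N.
Proof.
move=> nz2 /(all_two_unit_sqr1 nz2) sqr1.
rewrite -[3%N]/(size [:: (0 : F); 1; -1]).
apply: leq_trans (card_size _); apply/subset_leq_card/subsetP => b _.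
rewrite !inE -sqrf_eq1; have [//|nzb] /= := eqVneq b 0.
by rewrite sqr1 ?eqxx.
Qed.

(** Squares of nonzero elements are 1, so the norm vanishes only at 0, and the
    two nonzero norms satisfy the criterion with r = 0 and r = 1. *)
Lemma F3_all_two_unit (F : finFieldType) :
  #|F| = 3%N -> forall x : 'rV[F]_2, sum_of_unit_vectors 2 x.
Proof.
move=> cardF x.
have c3 : (3%:R : F) = 0.
  by apply/pcharf0/(@card_finPcharP _ 3 1); rewrite ?cardF.
have nz2 : (2%:R : F) != 0.
  apply: contra_eq_neq c3 => c2.
  by rewrite -[3%N]/(2 + 1)%N natrD c2 add0r oner_eq0.
have sqr1 (b : F) : b != 0 -> b ^+ 2 = 1.
  move=> nzb; apply: (mulfI nzb); rewrite mulr1 -exprS -[in RHS](expf_card b).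
  by rewrite cardF.
have [nx0|nzx] := eqVneq (sqnorm x) 0; last first.
  apply: two_unit_norm_sum => //; move/sqr1/eqP: nzx; rewrite sqrf_eq1.
  case/orP=> /eqP->.
    by exists 0; apply: (eq_of_multiple (k := -1) c3); ring.
  by exists 1; apply: (eq_of_multiple (k := -2%:R) c3); ring.
suff -> : x = 0 by apply: sum_of_two_unit_vectors0.
move: nx0; rewrite sqnorm2 => nx0.
have [x0 | /sqr1 x0] := eqVneq (x 0 0) 0.
  move: nx0; rewrite x0 expr0n add0r => /eqP; rewrite sqrf_eq0 => /eqP x1.
  by apply: row2_eq; rewrite mxE.
have [x1 | /sqr1 x1] := eqVneq (x 0 1) 0; move/eqP: nx0.
  by rewrite x0 x1 expr0n addr0 oner_eq0.
by rewrite x0 x1 -[1 + 1]/(2%:R) (negPf nz2).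
Qed.

(** * Square roots of -1, -3 and 3 in a finite field *)

Lemma card_finField_gt1 (F : finFieldType) : (1 < #|F|)%N.
Proof. exact: finNzRing_gt1. Qed.

(** Otherwise 'X^k - 1 would have more roots than its degree. *)
Lemma exists_expf_neq1 (F : finFieldType) k :
  (0 < k < #|F|.-1)%N -> exists2 g : F, g != 0 & g ^+ k != 1.
Proof.
case/andP=> k_gt0 lt_k.
have [/existsP[g /andP[]]|/pred0Pn none] :=
  boolP [exists g : F, (g != 0) && (g ^+ k != 1)]; first by exists g.
have all1 (g : F) : g != 0 -> g ^+ k = 1.
  move=> nzg; apply/eqP; apply: contra_notT none => nz1; exists g.
  by rewrite /= nzg.
have nzp : 'X^k - 1%:P != 0 :> {poly F}.
  by rewrite -size_poly_eq0 size_XnsubC.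
have : all (root ('X^k - 1%:P)) (enum (predC1 (0 : F))).
  apply/allP => g; rewrite mem_enum !inE => /all1 g1.
  by rewrite rootE !hornerE g1 subrr.
move/(max_poly_roots nzp) => /(_ (enum_uniq _)).
by rewrite size_XnsubC // -cardE cardC1 ltnS leqNgt lt_k.
Qed.

Lemma expf_card_pred (F : finFieldType) (x : F) : x != 0 -> x ^+ #|F|.-1 = 1.
Proof.
move=> nzx; apply: (mulfI nzx); rewrite -exprS mulr1 prednK ?expf_card //.
by apply: ltn_trans (finNzRing_gt1 F).
Qed.

(** For q = 4 m + 3, i^(q - 1) = (i^2)^(2 m + 1) = -1 contradicts
    i^(q - 1) = 1. *)
Lemma sqrt_m1_card (F : finFieldType) (i : F) : (2%:R : F) != 0 ->
  i ^+ 2 = -1 -> #|F| <> 3 %[mod 4].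
Proof.
move=> nz2 i2 cardF.
have nzi : i != 0.
  by apply: contra_eq_neq i2 => ->; rewrite expr0n eq_sym oppr_eq0 oner_eq0.
have := expf_card_pred nzi.
have -> : #|F|.-1 = (2 * (2 * (#|F| %/ 4)).+1)%N by lia.
rewrite exprM i2 exprS exprM sqrrN expr1n expr1n mulr1 => /eqP.
by rewrite eq_sym -addr_eq0 (negPf nz2).
Qed.

(** For q = 4 m + 1, some g^(2 m) is a square root of 1 other than 1, so it is
    -1, and g^m is the root sought. *)
Lemma exists_sqrt_m1 (F : finFieldType) :
  #|F| = 1 %[mod 4] -> exists i : F, i ^+ 2 = -1.
Proof.
move=> cardF; have F_gt1 := card_finField_gt1 F.
have predF : #|F|.-1 = (2 * (#|F| %/ 4) * 2)%N by lia.
have [|g nzg gk] := @exists_expf_neq1 F (2 * (#|F| %/ 4)); first lia.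
exists (g ^+ (#|F| %/ 4)); rewrite -exprM mulnC.
have : (g ^+ (2 * (#|F| %/ 4))) ^+ 2 == 1.
  by rewrite -exprM -predF expf_card_pred.
by rewrite sqrf_eq1 (negPf gk) => /eqP.
Qed.

(** For q = 4 m + 3, x^(2 m + 1) = 1 or -1; since 2 m + 1 is odd, one of x and
    -x has power 1, and an element y with y^(2 m + 1) = 1 is (y^(m + 1))^2. *)
Lemma sqr_or_opp_sqr (F : finFieldType) (x : F) :
  #|F| = 3 %[mod 4] -> (exists r, r ^+ 2 = x) \/ (exists r, r ^+ 2 = - x).
Proof.
move=> cardF.
have [->|nzx] := eqVneq x 0; first by left; exists 0; rewrite expr0n.
have predF : #|F|.-1 = ((2 * (#|F| %/ 4)).+1 * 2)%N by lia.
have sqrE (y : F) : y ^+ (2 * (#|F| %/ 4)).+1 = 1 -> exists r, r ^+ 2 = y.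
  move=> y1; exists (y ^+ (#|F| %/ 4).+1); rewrite -exprM.
  by rewrite -[RHS]mulr1 -y1 -exprS; congr (_ ^+ _); lia.
have : (x ^+ (2 * (#|F| %/ 4)).+1) ^+ 2 == 1.
  by rewrite -exprM -predF expf_card_pred.
rewrite sqrf_eq1 => /orP[] /eqP xE; [left | right]; apply: sqrE => //.
rewrite exprNn xE exprS exprM sqrrN !expr1n; ring.
Qed.

(** A square root r of -3 gives the cube root of unity w = (r - 1) / 2, and for
    q = 3 m + 2 the relation w^(q - 1) = 1 would give w = 1. *)
Lemma sqrt_m3_card (F : finFieldType) (r : F) :
  (2%:R : F) != 0 -> (3%:R : F) != 0 -> r ^+ 2 = - 3%:R -> #|F| <> 2 %[mod 3].
Proof.
move=> nz2 nz3 r2 cardF; pose w := (r - 1) / 2%:R.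
have nz4 := natr4_neq0 nz2.
have w2 : w ^+ 2 + w + 1 = 0.
  by rewrite /w; apply: (eq_of_multiple (k := 4%:R^-1) r2); field; rewrite nz4.
have w3 : w ^+ 3 = 1 by apply: (eq_of_multiple (k := w - 1) w2); ring.
have nzw : w != 0.
  by apply: contra_eq_neq w3 => ->; rewrite expr0n eq_sym oner_eq0.
have := expf_card_pred nzw.
have -> : #|F|.-1 = (3 * (#|F| %/ 3)).+1 by have := card_finField_gt1 F; lia.
rewrite exprS exprM w3 expr1n mulr1 => w1; case/eqP: nz3.
by rewrite -w2 w1; ring.
Qed.

(** For q = 3 m + 1, some w = g^m is a primitive cube root of unity, and then
    (2 w + 1)^2 = -3. *)
Lemma exists_sqrt_m3 (F : finFieldType) :
  #|F| = 1 %[mod 3] -> exists r : F, r ^+ 2 = - 3%:R.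
Proof.
move=> cardF; have F_gt1 := card_finField_gt1 F.
have predF : #|F|.-1 = (#|F| %/ 3 * 3)%N by lia.
have [|g nzg gk] := @exists_expf_neq1 F (#|F| %/ 3); first lia.
set w := g ^+ _ in gk; exists (2%:R * w + 1).
have w3 : w ^+ 3 = 1.
  by rewrite -exprM -predF expf_card_pred.
have w2 : w ^+ 2 + w + 1 = 0.
  move: gk; rewrite -subr_eq0 => nzw; apply: (mulfI nzw).
  by apply: (eq_of_multiple (k := 1) w3); ring.
by apply: (eq_of_multiple (k := 4%:R) w2); ring.
Qed.

(** The residue of q modulo 4 decides whether -1 is a square, its residue modulo
    3 whether -3 is.  When -1 is not a square, exactly one of 3 and -3 is. *)
Lemma sqrt3P (F : finFieldType) :
  (2%:R : F) != 0 -> (3%:R : F) != 0 -> odd #|F| -> ~~ (3 %| #|F|)%N ->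
  (exists r : F, r ^+ 2 = 3%:R) <-> #|F| = 1 %[mod 12] \/ #|F| = 11 %[mod 12].
Proof.
move=> nz2 nz3 oddF n3F.
have [F1 | F3] : #|F| = 1 %[mod 4] \/ #|F| = 3 %[mod 4] by lia.
  have [i i2] := exists_sqrt_m1 F1.
  have [G1 | G2] : #|F| = 1 %[mod 3] \/ #|F| = 2 %[mod 3] by lia.
    split=> _; first by left; lia.
    have [r r2] := exists_sqrt_m3 G1; exists (i * r).
    by rewrite exprMn i2 r2 mulrNN mul1r.
  split=> [[r r2] | ]; last lia.
  case: (@sqrt_m3_card F (i * r)) => //.
  by rewrite exprMn i2 r2 mulN1r.
have [G1 | G2] : #|F| = 1 %[mod 3] \/ #|F| = 2 %[mod 3] by lia.
  split=> [[r r2] | ]; last lia.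
  have [s s2] := exists_sqrt_m3 G1.
  case: (@sqrt_m1_card F (s / r)) => //.
  by rewrite expr_div_n s2 r2 mulNr divff.
split=> [_ | _]; first by right; lia.
have [[r r2] | [r r2]] := sqr_or_opp_sqr (3%:R : F) F3; first by exists r.
by case: (@sqrt_m3_card F r).
Qed.

(** Here p^2 = 1 modulo 12, so only the parity of n matters. *)
Lemma expn_mod12 p n : prime p -> odd p -> p <> 3%N ->
  (p ^ n = 1 %[mod 12] \/ p ^ n = 11 %[mod 12])%N <->
    [\/ p = 1 %[mod 12], p = 3 %[mod 12], p = 11 %[mod 12] | ~~ odd n].
Proof.
move=> p_prime p_odd p3.
have n3p : ~~ (3 %| p)%N.
  by apply/negP => /(prime_nt_dvdP p_prime) => /(_ isT) /esym.
have p_mod12 : (p %% 12 = 1 \/ p %% 12 = 5 \/ p %% 12 = 7 \/ p %% 12 = 11)%N.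
  by lia.
have sqp : (p ^ 2 = 1 %[mod 12])%N.
  by rewrite -modnXm; case: p_mod12 => [|[|[|]]] ->.
have expE : (p ^ n = (if odd n then p else 1) %[mod 12])%N.
  rewrite -{1}(odd_double_half n) -mul2n expnD expnM.
  rewrite -modnMmr -modnXm sqp modnXm.
  by rewrite exp1n modnMmr muln1; case: odd; rewrite ?expn1.
rewrite !expE; case: odd => /=; last first.
  by split=> _; [apply: Or44 | left].
split=> [[] e|]; [exact: Or41 | exact: Or43 |].
case=> // e; [by left | | by right].
by lia.
Qed.

(** * Three unit vectors in an anisotropic plane *)

Lemma card_le_double_imset (S T : finType) (D : {set S}) (f : S -> T)
    (g : S -> S) :
  {in D &, forall u v, f u = f v -> v = u \/ v = g u} ->
  (#|D| <= 2 * #|f @: D|)%N.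
Proof.
move=> fg; rewrite -sum1_card (partition_big_imset f) /= mulnC -sum_nat_const.
apply: leq_sum => _ /imsetP[u Du ->]; rewrite sum1_card.
apply: leq_trans (card_size [:: u; g u]); apply/subset_leq_card/subsetP => v.
rewrite !inE => /andP[Dv /eqP/esym/(fg u v Du Dv)].
by case=> ->; rewrite eqxx ?orbT.
Qed.

Lemma card_gt_meet (T : finType) (A B : {set T}) :
  (#|T| < #|A| + #|B|)%N -> exists2 z, z \in A & z \in B.
Proof.
move=> ltAB; have : (0 < #|A :&: B|)%N.
  have := subset_leq_card (subsetT (A :|: B)); rewrite cardsU cardsT => leAB.
  have := subset_leq_card (subsetIl A B); clear -ltAB leAB; lia.
by case/card_gt0P => z /setIP[]; exists z.
Qed.

Lemma sum_sqr_eq0 (F : finFieldType) (a b : F) :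
  (forall i : F, i ^+ 2 != -1) -> a ^+ 2 + b ^+ 2 = 0 -> a = 0 /\ b = 0.
Proof.
move=> no_i ab0; have [b0 | nzb] := eqVneq b 0.
  move: ab0; rewrite b0 expr0n addr0 => /eqP; rewrite sqrf_eq0 => /eqP -> //.
case/eqP: (no_i (a / b)); rewrite expr_div_n; apply/eqP.
rewrite -subr_eq0 opprK.
by rewrite -[X in _ + X](divff (expf_neq0 2 nzb)) -mulrDl ab0 mul0r.
Qed.

Lemma sqnorm_eq0 (F : finFieldType) (x : 'rV[F]_2) :
  (forall i : F, i ^+ 2 != -1) -> sqnorm x = 0 -> x = 0.
Proof.
by move=> no_i; rewrite sqnorm2 => /(sum_sqr_eq0 no_i)[x0 x1];
  apply: row2_eq; rewrite mxE.
Qed.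

Definition unit_circle (F : finFieldType) : {set 'rV[F]_2} :=
  [set u | sqnorm u == 1].

(** The rational parametrization m |-> ((1 - m^2) / (1 + m^2), 2 m / (1 + m^2))
    is injective and defined everywhere, as 1 + m^2 never vanishes. *)
Lemma card_unit_circle (F : finFieldType) : (2%:R : F) != 0 ->
  (forall i : F, i ^+ 2 != -1) -> (#|F| <= #|unit_circle F|)%N.
Proof.
move=> nz2 no_i.
have nzD (m : F) : 1 + m ^+ 2 != 0.
  by rewrite addrC addr_eq0 no_i.
pose h (m : F) := vec2 ((1 - m ^+ 2) / (1 + m ^+ 2)) (2%:R * m / (1 + m ^+ 2)).
have hK : cancel h (fun u => u 0 1 / (1 + u 0 0)).
  move=> m; rewrite /h vec2_0 vec2_1.
  have -> : 1 + (1 - m ^+ 2) / (1 + m ^+ 2) = 2%:R / (1 + m ^+ 2).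
    by field; exact: nzD.
  by field; rewrite nzD nz2.
rewrite -[#|F|]cardsT -(card_imset setT (can_inj hK)).
apply/subset_leq_card/subsetP => _ /imsetP[m _ ->].
by rewrite inE /h sqnorm_vec2; apply/eqP; field; exact: nzD.
Qed.

(** The dot product and the cross product with x determine u, and by Lagrange's
    identity the first determines the second up to sign; the change of sign is
    the reflection in the line spanned by x. *)
Lemma dot2_unit_fiber (F : finFieldType) (x u v : 'rV[F]_2) :
  sqnorm x != 0 -> sqnorm u = 1 -> sqnorm v = 1 -> dot2 x u = dot2 x v ->
  v = u \/ v = (2%:R * dot2 x u / sqnorm x) *: x - u.
Proof.
move=> nzx u1 v1 dotE.
pose cr (w : 'rV[F]_2) := x 0 0 * w 0 1 - x 0 1 * w 0 0.
have coord0 (w : 'rV[F]_2) :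
    w 0 0 = (x 0 0 * dot2 x w - x 0 1 * cr w) / sqnorm x.
  by move: nzx; rewrite sqnorm2 /dot2 /cr => nzx; field.
have coord1 (w : 'rV[F]_2) :
    w 0 1 = (x 0 1 * dot2 x w + x 0 0 * cr w) / sqnorm x.
  by move: nzx; rewrite sqnorm2 /dot2 /cr => nzx; field.
have crE (w : 'rV[F]_2) : sqnorm w = 1 -> cr w ^+ 2 = sqnorm x - dot2 x w ^+ 2.
  move=> w1; rewrite -[sqnorm x]mulr1 -[in RHS]w1 !sqnorm2 /cr /dot2; ring.
have : cr v ^+ 2 == cr u ^+ 2 by rewrite !crE // dotE.
(* Equal cross products give v = u, opposite ones the reflection. *)
rewrite eqf_sqr => /orP[] /eqP crvE; [left | right]; apply: row2_eq.
- by rewrite (coord0 v) -dotE crvE -coord0.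
- by rewrite (coord1 v) -dotE crvE -coord1.
- by rewrite !mxE (coord0 v) (coord0 u) -dotE crvE; field.
- by rewrite !mxE (coord1 v) (coord1 u) -dotE crvE; field.
Qed.

(** The fibers have at most two elements, which gives q <= 2 k for the number k
    of values; equality is impossible because q is odd. *)
Lemma card_dot2_unit_circle (F : finFieldType) (x : 'rV[F]_2) :
  (2%:R : F) != 0 -> odd #|F| -> (forall i : F, i ^+ 2 != -1) ->
  sqnorm x != 0 -> (#|F| < 2 * #|[set dot2 x u | u in unit_circle F]|)%N.
Proof.
move=> nz2 oddF no_i nzx.
have leU : (#|unit_circle F| <= 2 * #|[set dot2 x u | u in unit_circle F]|)%N.
  apply: card_le_double_imset => u v; rewrite !inE => /eqP u1 /eqP v1.
  exact: dot2_unit_fiber.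
have := leq_trans (card_unit_circle nz2 no_i) leU.
rewrite leq_eqVlt => /orP[/eqP cardF | //].
by move: oddF; rewrite cardF oddM.
Qed.

(** The norms ||x - u|| and ||e1 + v||, for u and v on the unit circle, each
    take more than q / 2 values, so they have a common value N.  If N <> 0, the
    two-unit criterion passes from e1 + v to x - u, which has the same norm; if
    N = 0, then x = u. *)
Lemma three_unit_anisotropic (F : finFieldType) (x : 'rV[F]_2) :
  (2%:R : F) != 0 -> odd #|F| -> (forall i : F, i ^+ 2 != -1) ->
  x <> 0 -> sum_of_unit_vectors 3 x.
Proof.
move=> nz2 oddF no_i nzx.
have {nzx} nzx : sqnorm x != 0.
  by apply/eqP => /(sqnorm_eq0 no_i).
pose A := [set sqnorm x + 1 - 2%:R * s |
             s in [set dot2 x u | u in unit_circle F]].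
pose B := [set 2%:R + 2%:R * s |
             s in [set dot2 (vec2 1 0) u | u in unit_circle F]].
have [|N] := @card_gt_meet F A B.
  have inj2 := mulfI nz2.
  have injA : injective (fun s : F => sqnorm x + 1 - 2%:R * s).
    by move=> s t e; apply/inj2/oppr_inj/(addrI _ e).
  have injB : injective (fun s : F => 2%:R + 2%:R * s).
    by move=> s t e; apply/inj2/(addrI _ e).
  rewrite (card_imset _ injA) (card_imset _ injB).
  have nze : sqnorm (vec2 (1 : F) 0) != 0 by rewrite unit_e1 oner_neq0.
  have half_lt (m a b : nat) : (m < 2 * a -> m < 2 * b -> m < a + b)%N by lia.
  by apply: half_lt; apply: card_dot2_unit_circle.
case/imsetP=> s /imsetP[u]; rewrite inE => /eqP u1 -> NE.
case/imsetP=> t /imsetP[v]; rewrite inE => /eqP v1 -> NvE.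
apply: (sum_of_unit_vectorsS u1).
have {}NE : sqnorm (x - u) = N by rewrite sqnormB u1 NE.
have [N0 | nzN] := eqVneq N 0.
  rewrite (sqnorm_eq0 no_i (x := x - u)) ?NE //.
  exact: sum_of_two_unit_vectors0.
apply: two_unit_norm_sum => //; rewrite NE; exists (2%:R * v 0 1 / N).
move: v1 NvE; rewrite sqnorm2 /dot2 vec2_0 vec2_1 => v1 NvE.
(* With N = 2 + 2 c and c^2 + d^2 = 1, N (4 - N) = 4 (1 - c^2) = (2 d)^2. *)
have sqE : (2%:R * v 0 1) ^+ 2 = N * (4%:R - N).
  by rewrite NvE; apply: (eq_of_multiple (k := 4%:R) v1); ring.
by rewrite expr_div_n sqE; field.
Qed.

(** * Four unit vectors in an isotropic plane *)

Lemma sum_finField (F : finFieldType) : (2%:R : F) != 0 -> \sum_(z : F) z = 0.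
Proof.
move=> nz2; have : \sum_(z : F) z = - \sum_(z : F) z.
  by rewrite {1}(reindex_inj oppr_inj) sumrN.
move/eqP; rewrite -subr_eq0 opprK -mulr2n -mulr_natl mulf_eq0 (negPf nz2).
by move/eqP.
Qed.

(** Translating by 1 does not change the sum of all elements. *)
Lemma natr_card_finField (F : finFieldType) : (#|F|%:R : F) = 0.
Proof.
have : \sum_(z : F) z = \sum_(z : F) (z + 1).
  exact: (reindex_inj (addIr 1)).
by rewrite big_split /= sumr_const -{1}[\sum_(z : F) z]addr0 => /addrI.
Qed.

Definition two_unit_norms (F : finFieldType) : {set F} :=
  [set N | [exists r, N * (1 + r ^+ 2) == 4%:R]].

Lemma two_unit_normsP (F : finFieldType) (N : F) :
  reflect (two_unit_norm N) (N \in two_unit_norms F).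
Proof.
by rewrite inE; apply: (iffP existsP) => -[r /eqP]; exists r => //; apply/eqP.
Qed.

Lemma two_unit_norm4 (F : finFieldType) : two_unit_norm (4%:R : F).
Proof. by exists 0; ring. Qed.

Lemma two_unit_norm2 (F : finFieldType) : two_unit_norm (2%:R : F).
Proof. by exists 1; ring. Qed.

Lemma two_unit_norms_neq0 (F : finFieldType) (N : F) :
  (2%:R : F) != 0 -> N \in two_unit_norms F -> N != 0.
Proof.
move=> /natr4_neq0 nz4 /two_unit_normsP[r]; apply: contra_eq_neq => ->.
by rewrite mul0r eq_sym.
Qed.

(** The norms are the values 4 / (1 + r^2) with r different from i and -i, and
    opposite r are the only ones with the same value; so 2 |S| >= q - 2, and
    q - 2 is odd. *)
Lemma card_two_unit_norms (F : finFieldType) (i : F) :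
  (2%:R : F) != 0 -> odd #|F| -> i ^+ 2 = -1 ->
  (#|F| <= (2 * #|two_unit_norms F|).+1)%N.
Proof.
move=> nz2 oddF i2; have nz4 := natr4_neq0 nz2.
pose D := ~: [set i; - i].
have nzD r : r \in D -> 1 + r ^+ 2 != 0.
  by rewrite !inE -eqf_sqr i2 addrC addr_eq0.
pose f (r : F) := 4%:R / (1 + r ^+ 2).
have leD : (#|D| <= 2 * #|f @: D|)%N.
  apply: (card_le_double_imset (g := -%R)) => u v Du Dv /(mulfI nz4)/invr_inj.
  by move/addrI/eqP; rewrite eq_sym eqf_sqr => /orP[] /eqP; [left | right].
have leS : (#|f @: D| <= #|two_unit_norms F|)%N.
  apply/subset_leq_card/subsetP => _ /imsetP[r Dr ->]; apply/two_unit_normsP.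
  by exists r; rewrite /f divfK // nzD.
have cardD : (#|F| <= #|D| + 2)%N.
  have := cardsC [set i; - i]; rewrite -/D => <-.
  by rewrite addnC leq_add2l cards2; case: eqP.
have le2 : (#|F| <= 2 * #|two_unit_norms F| + 2)%N.
  apply: leq_trans cardD _; rewrite leq_add2r.
  by apply: leq_trans leD _; rewrite leq_mul2l.
rewrite leqNgt; apply: contraL oddF => lt_card.
have -> : #|F| = (2 * #|two_unit_norms F| + 2)%N.
  by apply/eqP; rewrite eqn_leq le2 addn2.
by rewrite oddD oddM.
Qed.

(** Suppose that there is no such pair.  For t <> 0, 1 the sets X t = S / t and
    Y t = M - S / (1 - t) are disjoint; as 2 |S| >= q - 1 this gives
    2 |S| = q - 1.  If M (1 - t) is outside S, neither set contains 0, so they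
    partition F \ {0}, and the sum of all elements of F, which is 0, becomes a
    quadratic equation for t with leading coefficient - M |S| = M / 2.  Since at
    least q - 2 - |S| elements t are of this kind and at most two are roots,
    q <= 7, hence q = 5 as -1 is a square.  In F_5, where S contains 2 and 4,
    M is 1 or 3, so that M / 4 is 4 or 2 and the two equal halves of (M, 1)
    will do. *)
Lemma norm_splitting (F : finFieldType) (i M : F) :
  (2%:R : F) != 0 -> odd #|F| -> i ^+ 2 = -1 -> M != 0 ->
  M \notin two_unit_norms F ->
  exists s t, s * t \in two_unit_norms F /\
              (M - s) * (1 - t) \in two_unit_norms F.
Proof.
move=> nz2 oddF i2 nzM nSM; set S := two_unit_norms F in nSM *.
have nz4 := natr4_neq0 nz2.
have [/existsP[s /existsP[t /andP[]]]|] :=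
  boolP [exists s, [exists t, (s * t \in S) && ((M - s) * (1 - t) \in S)]].
  by exists s, t.
rewrite negb_exists => /forallP none; exfalso.
have {}none s t : s * t \in S -> (M - s) * (1 - t) \in S -> False.
  by move=> ? ?; case/existsP: (none s); exists t; apply/andP.
pose X t := [set N / t | N in S]; pose Y t := [set M - N / (1 - t) | N in S].
have injX t : t != 0 -> injective (fun N : F => N / t).
  by move=> nzt; apply: mulIf; rewrite invr_eq0.
have injY t : t != 1 -> injective (fun N : F => M - N / (1 - t)).
  move=> nzt u v e; apply/(injX (1 - t))/oppr_inj/(addrI _ e).
  by rewrite subr_eq0 eq_sym.
have XY0 t z : t != 0 -> t != 1 -> z \in X t -> z \in Y t -> False.
  move=> t0 t1 /imsetP[u Su uE] /imsetP[v Sv vE]; apply: (none z t).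
    by rewrite uE divfK.
  by rewrite vE opprB addrCA subrr addr0 divfK // subr_eq0 eq_sym.
have cardX t : t != 0 -> #|X t| = #|S| by move=> t0; apply/card_imset/injX.
have cardY t : t != 1 -> #|Y t| = #|S| by move=> t1; apply/card_imset/injY.
have cardS : #|F| = (2 * #|S|).+1.
  apply/eqP; rewrite eqn_leq (card_two_unit_norms nz2 oddF i2) ltn_neqAle.
  have -> : (2 * #|S|)%N != #|F|.
    by apply: contraTneq oddF => <-; rewrite oddM.
  have t0 : (2%:R^-1 : F) != 0 by rewrite invr_eq0.
  have t1 : (2%:R^-1 : F) != 1.
    rewrite invr_eq1 -subr_eq0; have -> : 2%:R - 1 = 1 :> F by ring.
    exact: oner_neq0.
  rewrite leqNgt; apply/negP => lt_card.
  have [|z] := @card_gt_meet F (X 2%:R^-1) (Y 2%:R^-1); last exact: XY0.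
  by rewrite cardX // cardY // addnn -mul2n.
pose k : F := #|S|%:R.
have kE : 2%:R * k = -1.
  apply/eqP; rewrite -addr_eq0 /k -natrM natr1 -cardS.
  by rewrite natr_card_finField.
pose sg := \sum_(N in S) N.
(* R0 consists of the t <> 0, 1 for which M (1 - t) is outside S. *)
pose R0 := ~: ([set 0; 1] :|: [set 1 - N / M | N in S]).
have R0P t : t \in R0 -> [/\ t != 0, t != 1 & M * (1 - t) \notin S].
  rewrite in_setC in_setU in_set2 !negb_or -andbA => /and3P[t0 t1 tS].
  split=> //.
  apply: contra tS => tS; apply/imsetP; exists (M * (1 - t)) => //.
  by field.
have rowE t : t \in R0 -> sg * (1 - 2%:R * t) + M * k * t * (1 - t) = 0.
  case/R0P => t0 t1 tS.
  have nt1 : 1 - t != 0 by rewrite subr_eq0 eq_sym.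
  have XYE : X t :|: Y t = [set~ 0].
    apply/eqP; rewrite eqEcard; apply/andP; split.
      apply/subsetP => z; rewrite !inE => /orP[] /imsetP[N SN ->].
        by rewrite mulf_neq0 ?invr_eq0 // (two_unit_norms_neq0 nz2 SN).
      apply: contra tS; rewrite subr_eq0 => /eqP ->.
      by rewrite divfK.
    rewrite cardsC1 cardS /= cardsU cardX // cardY //.
    have -> : X t :&: Y t = set0.
      apply/setP => z; rewrite !inE; apply/negP => /andP[].
      exact: XY0.
    by rewrite cards0 subn0 mul2n addnn.
  have sumE : \sum_(z in X t) z + \sum_(z in Y t) z = 0.
    rewrite -bigU /=; last first.
      rewrite disjoints_subset; apply/subsetP => z Xz.
      by rewrite in_setC; apply/negP; apply: XY0.
    rewrite -[RHS](sum_finField nz2) [in RHS](bigD1 0) //= add0r.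
    by apply: eq_bigl => z; rewrite inE /= -in_setU XYE in_setC1.
  move: sumE; rewrite !big_imset /=; first last.
  - by move=> u v _ _; apply: injX.
  - by move=> u v _ _; apply: injY.
  rewrite sumrB -!mulr_suml sumr_const -/sg -mulr_natr -/k => sumE.
  by apply: (eq_of_multiple (k := t * (1 - t)) sumE); field; rewrite t0 nt1.
pose p : {poly F} := - (M * k) *: 'X^2 + (M * k - 2%:R * sg) *: 'X + sg%:P.
have nzk : k != 0.
  by apply: contra_eq_neq kE => ->; rewrite mulr0 eq_sym oppr_eq0 oner_eq0.
have p2 : p`_2 = - (M * k).
  by rewrite !coefE /=; ring.
have nzp : p != 0.
  by apply: contra_eq_neq p2 => ->; rewrite coef0 eq_sym oppr_eq0 mulf_neq0.
have size_p : (size p <= 3)%N.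
  apply/leq_sizeP => j; rewrite !coefE => j3.
  by case: j j3 => [|[|[|j]]] //= _; ring.
have cardR0 : (#|R0| <= 2)%N.
  have rootR0 : all (root p) (enum R0).
    apply/allP => t; rewrite mem_enum => /rowE tE.
    rewrite rootE !(hornerD, hornerZ, hornerXn, hornerX, hornerC).
    by rewrite -[X in _ == X]tE; apply/eqP; ring.
  have := max_poly_roots nzp rootR0 (enum_uniq _).
  by rewrite -cardE => ltR; have := leq_trans ltR size_p.
have cardCR0 : (#|F| <= #|R0| + 2 + #|S|)%N.
  rewrite -(cardsC R0) -addnA leq_add2l setCK.
  apply: leq_trans (leq_card_setU _ _) _; rewrite leq_add //.
    by rewrite cards2; case: eqP.
  exact: leq_imset_card.
(* Now q - 2 - (q - 1) / 2 <= 2, and q is not 3 or 7 since -1 is a square. *)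
have cardF5 : #|F| = 5%N.
  have := sqrt_m1_card nz2 i2; have := card_finField_gt1 F.
  move: cardS cardR0 cardCR0; clear; lia.
have c5 : (5%:R : F) = 0 by rewrite -cardF5 natr_card_finField.
(* In F_5, M / 4 = - M, and the halves (M / 2, 1 / 2) are (3 M, 3). *)
have SNM : - M \in S.
  have := expf_card_pred nzM; rewrite cardF5 /= => M4.
  have : (M - 1) * ((M + 1) * ((M - 2%:R) * (M + 2%:R))) == 0.
    apply/eqP; apply: (eq_of_multiple (k := 1) M4).
    by apply: (eq_of_multiple (k := 1 - M ^+ 2) c5); ring.
  have neg (N : F) : N \in S -> (M == N) = false.
    by move=> SN; apply: contraNF nSM => /eqP ->.
  have S4 := introT (two_unit_normsP _) (two_unit_norm4 F).
  have S2 := introT (two_unit_normsP _) (two_unit_norm2 F).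
  have S4E : (4%:R : F) = -1 by apply: (eq_of_multiple (k := 1) c5); ring.
  rewrite !mulf_eq0 !subr_eq0 !addr_eq0 -S4E (neg _ S4) (neg _ S2) /=.
  case/orP=> /eqP ->.
    by rewrite -S4E.
  by rewrite opprK.
apply: (none (3%:R * M) 3%:R).
  have -> // : 3%:R * M * 3%:R = - M.
  by apply: (eq_of_multiple (k := 2%:R * M) c5); ring.
have -> // : (M - 3%:R * M) * (1 - 3%:R) = - M.
by apply: (eq_of_multiple (k := M) c5); ring.
Qed.

(** In the coordinates c = a + i b, d = a - i b the norm is c d.  If just one of
    c, d vanishes, explicit splittings give norms 4 and 2; otherwise rescaling c
    and d by inverse factors preserves products and reduces to (c d, 1). *)
Lemma four_unit_isotropic (F : finFieldType) (i : F) (x : 'rV[F]_2) :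
  (2%:R : F) != 0 -> odd #|F| -> i ^+ 2 = -1 -> sum_of_unit_vectors 4 x.
Proof.
move=> nz2 oddF i2; have nz4 := natr4_neq0 nz2.
pose h (s t : F) := vec2 ((s + t) / 2%:R) ((t - s) * i / 2%:R).
have normh s t : sqnorm (h s t) = s * t.
  rewrite sqnorm_vec2.
  by apply: (eq_of_multiple (k := (t - s) ^+ 2 / 4%:R) i2); field; rewrite nz4.
pose c := x 0 0 + i * x 0 1; pose d := x 0 0 - i * x 0 1.
have xE : x = h c d.
  apply: row2_eq; rewrite ?vec2_0 ?vec2_1 /c /d; first by field.
  by apply: (eq_of_multiple (k := x 0 1) i2); field.
have sum4 s t : two_unit_norm (s * t) -> two_unit_norm ((c - s) * (d - t)) ->
    sum_of_unit_vectors 4 x.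
  move=> st cdst; have -> : x = h s t + h (c - s) (d - t).
    by rewrite xE; apply: row2_eq; rewrite !mxE /=; field.
  by apply: (@sum_of_unit_vectorsD _ _ 2 2);
    apply: two_unit_norm_sum; rewrite ?normh.
have sum2 : sum_of_unit_vectors 2 x -> sum_of_unit_vectors 4 x.
  move=> x2; rewrite -[x]addr0; apply: (@sum_of_unit_vectorsD _ _ 2 2) x2 _.
  exact: sum_of_two_unit_vectors0.
have [c0 | nzc] := eqVneq c 0; have [d0 | nzd] := eqVneq d 0.
- apply: sum2; suff -> : x = 0 by apply: sum_of_two_unit_vectors0.
  by rewrite xE c0 d0; apply: row2_eq; rewrite !mxE /=; ring.
- apply: (sum4 (2%:R / d) (2%:R * d)).
    have -> : 2%:R / d * (2%:R * d) = 4%:R by field.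
    exact: two_unit_norm4.
  have -> : (c - 2%:R / d) * (d - 2%:R * d) = 2%:R by rewrite c0; field.
  exact: two_unit_norm2.
- apply: (sum4 (2%:R * c) (2%:R / c)).
    have -> : 2%:R * c * (2%:R / c) = 4%:R by field.
    exact: two_unit_norm4.
  have -> : (c - 2%:R * c) * (d - 2%:R / c) = 2%:R by rewrite d0; field.
  exact: two_unit_norm2.
have [/two_unit_normsP Scd | nScd] := boolP (c * d \in two_unit_norms F).
  by apply/sum2/two_unit_norm_sum; rewrite // xE normh.
have [] := norm_splitting nz2 oddF i2 (mulf_neq0 nzc nzd) nScd.
move=> s [t [/two_unit_normsP st /two_unit_normsP cdst]].
apply: (sum4 (s / d) (d * t)).
  by have -> : s / d * (d * t) = s * t by field.
by have -> : (c - s / d) * (d - d * t) = (c * d - s) * (1 - t) by field.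
Qed.

(** Subtract e1, or -e1 if x = e1, to get a nonzero vector. *)
Lemma four_unit_anisotropic (F : finFieldType) (x : 'rV[F]_2) :
  (2%:R : F) != 0 -> odd #|F| -> (forall i : F, i ^+ 2 != -1) ->
  sum_of_unit_vectors 4 x.
Proof.
move=> nz2 oddF no_i.
pose e : 'rV[F]_2 := vec2 1 0.
have unit_e : unit_vector e := unit_e1 F.
have unit_Ne : unit_vector (- e) by rewrite /unit_vector sqnormN.
have [xe | xe] := eqVneq x e.
  apply: (sum_of_unit_vectorsS unit_Ne).
  apply: three_unit_anisotropic => //; rewrite xe opprK => /rowP/(_ 0).
  by rewrite !mxE => /eqP; rewrite -[_ + _]/(2%:R) (negPf nz2).
apply: (sum_of_unit_vectorsS unit_e).
by apply: three_unit_anisotropic => //; apply/eqP; rewrite subr_eq0.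
Qed.

Theorem proposition1p6 (F : finFieldType) (p n q : nat)
    (p_prime : prime p) (p_odd : odd p) (n_ge1 : (1 <= n)%N)
    (q_def : q = (p ^ n)%N) (card_F : #|F| = q) :
  [/\ (forall x : 'rV[F]_2, sum_of_unit_vectors 2 x) <-> q = 3%N,
      forall x : 'rV[F]_2, sum_of_unit_vectors 4 x,
      q = 3 %[mod 4] ->
        forall x : 'rV[F]_2, x <> 0 -> sum_of_unit_vectors 3 x
    & sum_of_unit_vectors 3 (0 : 'rV[F]_2) <->
        [\/ p = 1 %[mod 12], p = 3 %[mod 12], p = 11 %[mod 12]
          | ~~ odd n]].
Proof.
have cardF : #|F| = (p ^ n)%N by rewrite card_F.
have charF : p \in [pchar F] := card_finPcharP cardF p_prime.
have oddF : odd #|F| by rewrite cardF oddX p_odd orbT.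
have nzl l : prime l -> l != p -> (l%:R : F) != 0.
  by move=> pr_l; rewrite -(dvdn_pcharf charF) dvdn_prime2 // eq_sym.
have nz2 : (2%:R : F) != 0.
  by apply: nzl => //; apply: contraTneq p_odd => <-.
split.
- split=> [sum2 | q3]; last by apply: F3_all_two_unit; rewrite card_F.
  have := all_two_unit_card nz2 sum2; have := card_finField_gt1 F.
  by rewrite -card_F; move: oddF; clear; lia.
- move=> x; have [/existsP[i /eqP i2] | /existsPn no_i] :=
    boolP [exists i : F, i ^+ 2 == -1].
    exact: (four_unit_isotropic x nz2 oddF i2).
  exact: four_unit_anisotropic.
- move=> q3 x nzx; apply: three_unit_anisotropic => // i.
  by apply/eqP => /(sqrt_m1_card nz2); rewrite card_F.
rewrite (zero_three_unit nz2).
have [p3 | p3] := eqVneq p 3%N.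
  split=> _; first by rewrite p3; apply: Or42.
  by exists 0; rewrite -[in RHS]p3 (pcharf0 charF) expr0n.
have n3p : ~~ (3 %| p)%N by rewrite dvdn_prime2 // eq_sym.
rewrite sqrt3P //; last first.
- by rewrite cardF Euclid_dvdX // negb_and n3p.
- by apply: nzl => //; rewrite eq_sym.
by rewrite cardF; apply: expn_mod12 => //; apply/eqP.
Qed.
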